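(* Let $\{A,B,C\}\subset S^{1,1}$ be a non-contractible spatiolateral de Sitter triangle with side lengths $a,b,c$ opposite $A,B,C$ and angles $\alpha,\beta,\gamma$ at $A,B,C$, respectively. Then $$\cosh(\alpha)=\cosh(\beta)\cosh(\gamma)+\cos(a)\sinh(\beta)\sinh(\gamma),$$ $$\cosh(\beta)=\cosh(\alpha)\cosh(\gamma)+\cos(b)\sinh(\alpha)\sinh(\gamma),$$ $$\cosh(\gamma)=\cosh(\alpha)\cosh(\beta)+\cos(c)\sinh(\alpha)\sinh(\beta).$$
   Context: On $\mathbb{R}^3$ let $\langle\langle x,y\rangle\rangle=-x_1y_1+x_2y_2+x_3y_3$, $|||x|||=\sqrt{|\langle\langle x,x\rangle\rangle|}$, and let $\times$ be the Euclidean cross product. $S^{1,1}=\{x:\langle\langle x,x\rangle\rangle=1\}$. A two-dimensional linear subspace is spacelike if $\langle\langle\cdot,\cdot\rangle\rangle$ restricted to it is positive definite. For $A,B\in S^{1,1}$ with $A\ne\pm B$, the side between $A$ and $B$ is spacelike if $\operatorname{span}(A,B)$ is spacelike (equivalently $|\langle\langle A,B\rangle\rangle|<1$); its length is then $\arccos(\langle\langle A,B\rangle\rangle)\in(0,\pi)$, and the unit tangent vector at $A$ towards $B$ is $X_{AB}=\dfrac{B-\langle\langle A,B\rangle\rangle A}{|||A\times B|||}$. A spatiolateral triangle is a set of three distinct points $\{A,B,C\}\subset S^{1,1}$ all of whose sides are spacelike. It is contractible if, after projecting the vertices to the $(x_2,x_3)$-plane, there is a line through the origin such that all three projected points lie on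 one side of the line; otherwise it is non-contractible. Side lengths: $a$ between $B$ and $C$, $b$ between $A$ and $C$, $c$ between $A$ and $B$. The angle at $A$ is $\alpha=\operatorname{arcosh}(|\langle\langle X_{AB},X_{AC}\rangle\rangle|)\ge 0$, and analogously $\beta$ at $B$, $\gamma$ at $C$. *)

(* Defs.v *)
From HB Require Import structures.
From mathcomp Require Export all_boot all_order all_algebra.
From mathcomp Require Export all_classical all_reals all_analysis.

Set Implicit Arguments.
Unset Strict Implicit.
Unset Printing Implicit Defensive.

Import Order.TTheory GRing.Theory Num.Theory.

Local Open Scope ring_scope.
Local Open Scope classical_set_scope.

Definition cosh {R : realType} (x : R) : R := (expR x + expR (- x)) / 2.

Definition sinh {R : realType} (x : R) : R := (expR x - expR (- x)) / 2.

(* Inverse of cosh on [0, +oo[; meaningful for 1 <= x. *)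
Definition arcosh {R : realType} (x : R) : R :=
  xget 0 [set t : R | 0 <= t /\ cosh t = x].

(* A vector (x_1, x_2, x_3) has coordinates x 0 0, x 0 1, x 0 2. *)
Definition lorentz {R : realType} (x y : 'rV[R]_3) : R :=
  - (x 0 0 * y 0 0) + x 0 1 * y 0 1 + x 0 2 * y 0 2.

Definition lnorm {R : realType} (x : 'rV[R]_3) : R :=
  Num.sqrt `|lorentz x x|.

(* Euclidean cross product. *)
Definition cross {R : realType} (x y : 'rV[R]_3) : 'rV[R]_3 :=
  \row_(i < 3) [:: x 0 1 * y 0 2 - x 0 2 * y 0 1;
                   x 0 2 * y 0 0 - x 0 0 * y 0 2;
                   x 0 0 * y 0 1 - x 0 1 * y 0 0]`_i.

Definition deSitter (R : realType) : set 'rV[R]_3 :=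
  [set x | lorentz x x = 1].

Definition spacelike_plane {R : realType} (U : {vspace 'rV[R]_3}) : Prop :=
  \dim U = 2%N /\ (forall v, v \in U -> v != 0 -> 0 < lorentz v v).

(* The dimension condition in spacelike_plane excludes A = B and A = - B. *)
Definition spacelike_side {R : realType} (A B : 'rV[R]_3) : Prop :=
  spacelike_plane <<[:: A; B]>>%VS.

Definition side_length {R : realType} (A B : 'rV[R]_3) : R :=
  acos (lorentz A B).

Definition unit_tangent {R : realType} (A B : 'rV[R]_3) : 'rV[R]_3 :=
  (lnorm (cross A B))^-1 *: (B - lorentz A B *: A).

(* The angle at A of the triangle with vertices A, B, C. *)
Definition vertex_angle {R : realType} (A B C : 'rV[R]_3) : R :=
  arcosh `|lorentz (unit_tangent A B) (unit_tangent A C)|.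

Definition spatiolateral {R : realType} (A B C : 'rV[R]_3) : Prop :=
  [/\ [/\ deSitter A, deSitter B & deSitter C],
      [/\ A != B, A != C & B != C] &
      [/\ spacelike_side A B, spacelike_side A C & spacelike_side B C]].

Definition proj23 {R : realType} (x : 'rV[R]_3) : 'rV[R]_2 :=
  \row_(j < 2) [:: x 0 1; x 0 2]`_j.

(* The open half-plane bounded by the line through the origin with normal
   vector n, on the side towards which n points. *)
Definition half_plane {R : realType} (n : 'rV[R]_2) : set 'rV[R]_2 :=
  [set p | 0 < n 0 0 * p 0 0 + n 0 1 * p 0 1].

(* A line and a choice of one of its sides are given by a nonzero normal
   vector.  Requiring the points to be off the line is not a restriction for
   spatiolateral triangles: if <<A, A>> = <<B, B>> = 1 and the projections of
   A and B have opposite directions, then |<<A, B>>| >= 1. *)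
Definition contractible_triangle {R : realType} (A B C : 'rV[R]_3) : Prop :=
  exists2 n : 'rV[R]_2, n != 0 &
    [/\ half_plane n (proj23 A), half_plane n (proj23 B)
      & half_plane n (proj23 C)].

(* Main.v *)
(** Put [p = <<B,C>>], [q = <<A,C>>], [r = <<A,B>>].  Then [cosh alpha] is
    [|p - q r| / (sqrt (1 - q^2) sqrt (1 - r^2))] and [sinh alpha] is
    [sqrt K / (sqrt (1 - q^2) sqrt (1 - r^2))], where
    [K = p^2 + q^2 + r^2 - 2 p q r - 1 = det(A,B,C)^2].  The law then follows
    from [(q - p r) (r - p q) + p K = (q r - p) (1 - p^2)], provided [p - q r],
    [q - p r] and [r - p q] are all negative.  This sign condition is what
    non-contractibility gives: some combination [T = u A + v B + w C] with
    [v, w >= 0] not both zero projects to the origin, whence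
    [0 >= <<T,T>> = (u + v r + w q)^2 + v^2 (1 - r^2) + w^2 (1 - q^2)
    + 2 v w (p - q r)], which is impossible when [p - q r >= 0]. *)

From mathcomp Require Import ring lra.
Require Import Defs.

Set Implicit Arguments.
Unset Strict Implicit.

Import Order.TTheory GRing.Theory Num.Theory.
Local Open Scope ring_scope.

(** * Hyperbolic functions and the inverse of [cosh] *)

Section Hyperbolic.
Variable R : realType.
Implicit Types x t : R.

Lemma sinh_ge0 t : 0 <= t -> 0 <= sinh t.
Proof.
move=> t0; rewrite /sinh divr_ge0// subr_ge0 ler_expR.
by rewrite (le_trans _ t0)// oppr_le0.
Qed.

Lemma cosh2Bsinh2 t : cosh t ^+ 2 - sinh t ^+ 2 = 1.
Proof.
have e1 : expR t * expR (- t) = 1 by rewrite -expRD subrr expR0.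
rewrite /cosh /sinh.
transitivity (expR t * expR (- t)); last exact: e1.
by field.
Qed.

(** [xget] returns a member of its set as soon as there is one, and [ln (x + sqrt (x^2 - 1))] is
    one, since [x + s] and [x - s] are mutually inverse. *)
Lemma arcoshP x : 1 <= x -> 0 <= arcosh x /\ cosh (arcosh x) = x.
Proof.
move=> x1; rewrite /arcosh.
set S := (X in xget _ X).
suff : S (xget 0 S) by [].
apply: xgetPex.
pose s := Num.sqrt (x ^+ 2 - 1).
have s0 : 0 <= s by exact: sqrtr_ge0.
have s2 : s ^+ 2 = x ^+ 2 - 1 by rewrite sqr_sqrtr// subr_ge0 expr_ge1//; lra.
have y1 : 1 <= x + s by lra.
have y0 : 0 < x + s by lra.
exists (ln (x + s)); split; first exact: ln_ge0.
rewrite /cosh expRN lnK ?posrE//.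
have -> : (x + s)^-1 = x - s.
  apply: (mulfI (lt0r_neq0 y0)); rewrite divff ?gt_eqF//.
  have -> : (x + s) * (x - s) = x ^+ 2 - s ^+ 2 by ring.
  by rewrite s2; ring.
by field.
Qed.

Lemma sinh_arcosh x y : 1 <= x -> 0 <= y -> x ^+ 2 - 1 = y ^+ 2 ->
  sinh (arcosh x) = y.
Proof.
move=> x1 y0 xy; have [t0 tx] := arcoshP x1.
apply/eqP; rewrite -(eqrXn2 (n := 2))// ?sinh_ge0//.
by apply/eqP; rewrite -xy -{2}tx; have := cosh2Bsinh2 (arcosh x); lra.
Qed.

End Hyperbolic.

(** * A theorem of the alternative for two affine functions of one variable *)

Section Gordan.
Variable R : realFieldType.

(** Each positivity condition cuts out an open half-line, everything or nothing. If no common [N]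
    exists, a nonnegative combination of the two functions is a constant [<= 0], which certifies
    this. *)
Lemma affine_pair_gt0_pos (b1 b2 c1 c2 : R) : 0 <= b2 ->
  (exists N, 0 < b1 + N * b2 /\ 0 < c1 + N * c2) \/
  exists v w, [/\ 0 <= v, 0 <= w, 0 < v + w, v * b2 + w * c2 = 0
                & v * b1 + w * c1 <= 0].
Proof.
rewrite le_eqVlt => /predU1P[<-|b20].
  have [b10|b10] := lerP b1 0.
    by right; exists 1, 0; split; lra.
  have [->|c20] := eqVneq c2 0.
    have [c10|c10] := lerP c1 0; first by right; exists 0, 1; split; lra.
    by left; exists 0; lra.
  left; exists ((1 - c1) / c2); rewrite mulr0 addr0 divfK//.
  by split => //; lra.
have [c20|c20|->] := ltgtP c2 0.
- have [h|h] := ltrP (b1 * c2) (c1 * b2).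
    (* The conditions read [- b1 / b2 < N < - c1 / c2]; by [h] this interval is nonempty, and [N] is
       its midpoint. *)
    left; exists ((- b1 / b2 - c1 / c2) / 2).
    have nc20 : 0 < - c2 by lra.
    have bN : b1 + (- b1 / b2 - c1 / c2) / 2 * b2
      = (c1 * b2 - b1 * c2) / (2 * - c2) by field; rewrite (lt_eqF c20) (gt_eqF b20).
    have cN : c1 + (- b1 / b2 - c1 / c2) / 2 * c2
      = (c1 * b2 - b1 * c2) / (2 * b2) by field; rewrite (lt_eqF c20) (gt_eqF b20).
    by rewrite bN cN; split; apply: divr_gt0; lra.
  (* These weights cancel the slopes; the failure of [h] bounds the constant term. *)
  by right; exists (- c2), b2; split; lra.
(* Both slopes are positive: each summand makes one function positive and only increases the
   other. *)
- left; exists (((`|b1| + 1) / b2) + ((`|c1| + 1) / c2)).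
  have b2n : 0 < b2^-1 by rewrite invr_gt0.
  have c2n : 0 < c2^-1 by rewrite invr_gt0.
  have hb : 0 < (`|b1| + 1) / b2 * c2.
    by rewrite !mulr_gt0// ltr_wpDl.
  have hc : 0 < (`|c1| + 1) / c2 * b2.
    by rewrite !mulr_gt0// ltr_wpDl.
  have := ler_norm (- b1); have := ler_norm (- c1); rewrite !normrN => hc1 hb1.
  rewrite (mulrDl _ _ b2) (mulrDl _ _ c2) !divfK ?gt_eqF//.
  by split; lra.
- have [c10|c10] := lerP c1 0; first by right; exists 0, 1; split; lra.
  left; exists ((1 - b1) / b2); rewrite mulr0 addr0 divfK ?gt_eqF//.
  by split => //; lra.
Qed.

Lemma affine_pair_gt0 (b1 b2 c1 c2 : R) :
  (exists N, 0 < b1 + N * b2 /\ 0 < c1 + N * c2) \/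
  exists v w, [/\ 0 <= v, 0 <= w, 0 < v + w, v * b2 + w * c2 = 0
                & v * b1 + w * c1 <= 0].
Proof.
have [b20|b20] := lerP 0 b2; first exact: affine_pair_gt0_pos.
have nb20 : 0 <= - b2 by lra.
have [[N [hb hc]]|[v [w [v0 w0 vw h1 h2]]]] :=
  affine_pair_gt0_pos b1 c1 (- c2) nb20.
  by left; exists (- N); lra.
by right; exists v, w; split => //; lra.
Qed.

End Gordan.

(** * Lorentz identities, tangent vectors and spacelike sides *)

Section Lorentz.
Variable R : realType.
Implicit Types A B C : 'rV[R]_3.

Lemma lorentzC A B : lorentz A B = lorentz B A.
Proof. by rewrite /lorentz; ring. Qed.

(** Lagrange's identity, with the sign reversed because the form has determinant [-1]. *)
Lemma lorentz_cross A B : lorentz (cross A B) (cross A B) =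
  lorentz A B ^+ 2 - lorentz A A * lorentz B B.
Proof. by rewrite /lorentz /cross !mxE /=; ring. Qed.

(** The left side is minus the Gram determinant, the right side [det(A,B,C)^2]; the sign is again
    the determinant of the form. *)
Lemma lorentz_gram A B C :
  lorentz A A * lorentz B C ^+ 2 + lorentz B B * lorentz A C ^+ 2
  + lorentz C C * lorentz A B ^+ 2
  - 2 * lorentz A B * lorentz A C * lorentz B C
  - lorentz A A * lorentz B B * lorentz C C
  = (A 0 0 * cross B C 0 0 + A 0 1 * cross B C 0 1
     + A 0 2 * cross B C 0 2) ^+ 2.
Proof. by rewrite /lorentz /cross !mxE /=; ring. Qed.

Lemma deSitter_gram_ge0 A B C : deSitter A -> deSitter B -> deSitter C ->
  0 <= lorentz B C ^+ 2 + lorentz A C ^+ 2 + lorentz A B ^+ 2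
       - 2 * lorentz A B * lorentz A C * lorentz B C - 1.
Proof.
rewrite /deSitter/= => hA hB hC; have := lorentz_gram A B C.
by rewrite hA hB hC !mul1r => ->; exact: sqr_ge0.
Qed.

Lemma lorentz_unit_tangent A B C : deSitter A ->
  lorentz (unit_tangent A B) (unit_tangent A C) =
  (lorentz B C - lorentz A B * lorentz A C)
  / (lnorm (cross A B) * lnorm (cross A C)).
Proof.
rewrite /deSitter/= => hA; rewrite invfM /unit_tangent.
set m := (lnorm (cross A B))^-1; set n := (lnorm (cross A C))^-1.
set r := lorentz A B; set q := lorentz A C.
transitivity ((lorentz B C - r * lorentz A C - q * lorentz A B
               + r * q * lorentz A A) * (m * n)).
  by rewrite /lorentz !mxE; ring.
by rewrite hA -/r -/q; congr (_ * _); ring.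
Qed.

(** With [r = <<A,B>>], the vector [B - r A] lies in the plane and has square [1 - r^2]. It is
    nonzero, as otherwise the span would be a line. *)
Lemma spacelike_side_lt1 A B : deSitter A -> deSitter B ->
  spacelike_side A B -> lorentz A B ^+ 2 < 1.
Proof.
rewrite /deSitter/= => hA hB [dim2 pos].
have vin : B - lorentz A B *: A \in <<[:: A; B]>>%VS.
  by rewrite rpredB ?rpredZ// memv_span// !inE eqxx ?orbT.
have vn0 : B - lorentz A B *: A != 0.
  rewrite subr_eq0; apply/eqP => BA.
  have : (<<[:: A; B]>> <= <[A]>)%VS.
    apply/span_subvP => x; rewrite !inE => /orP[/eqP->|/eqP->].
      exact: memv_line.
    by rewrite BA rpredZ// memv_line.
  by move=> /dimvS; rewrite dim2 dim_vline; case: (A != 0).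
have E (r : R) : lorentz (B - r *: A) (B - r *: A) =
    lorentz B B - 2 * r * lorentz A B + r ^+ 2 * lorentz A A.
  by rewrite /lorentz !mxE; ring.
by have := pos _ vin vn0; rewrite E hA hB; lra.
Qed.

Lemma lnorm_cross A B : deSitter A -> deSitter B ->
  spacelike_side A B -> lnorm (cross A B) = Num.sqrt (1 - lorentz A B ^+ 2).
Proof.
move=> hA hB hAB; have r1 := spacelike_side_lt1 hA hB hAB.
rewrite /lnorm lorentz_cross hA hB mulr1 ler0_norm ?opprB//.
by rewrite subr_le0 ltW.
Qed.

Lemma cos_side_length A B : deSitter A -> deSitter B ->
  spacelike_side A B -> cos (side_length A B) = lorentz A B.
Proof.
move=> hA hB hAB; rewrite /side_length acosK//.
have := spacelike_side_lt1 hA hB hAB => r1.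
by rewrite in_itv /= -ler_norml -(expr_le1 (n := 2))// real_normK ?num_real// ltW.
Qed.

(** * Permutations of the vertices, and the sign condition from non-contractibility *)

Lemma spacelike_sideC A B : spacelike_side A B -> spacelike_side B A.
Proof.
suff -> : spacelike_side A B = spacelike_side B A by [].
by rewrite /spacelike_side !span_cons span_nil !addv0 addvC.
Qed.

Lemma spatiolateral_swap12 A B C : spatiolateral A B C -> spatiolateral B A C.
Proof.
move=> [[hA hB hC] [AB AC BC] [sAB sAC sBC]].
by split; split => //; [rewrite eq_sym | exact: spacelike_sideC].
Qed.

Lemma spatiolateral_swap23 A B C : spatiolateral A B C -> spatiolateral A C B.
Proof.
move=> [[hA hB hC] [AB AC BC] [sAB sAC sBC]].
by split; split => //; [rewrite eq_sym | exact: spacelike_sideC].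
Qed.

Lemma contractible_triangle_swap12 A B C :
  contractible_triangle A B C -> contractible_triangle B A C.
Proof. by move=> [n n0 [? ? ?]]; exists n. Qed.

Lemma contractible_triangle_swap23 A B C :
  contractible_triangle A B C -> contractible_triangle A C B.
Proof. by move=> [n n0 [? ? ?]]; exists n. Qed.

Lemma vertex_angleC A B C : vertex_angle A B C = vertex_angle A C B.
Proof. by rewrite /vertex_angle lorentzC. Qed.

(* [n] below is [a + N a^perp], where [a] is the projection of [A]. *)
Lemma noncontractible_combination A B C : deSitter A ->
  ~ contractible_triangle A B C ->
  exists u v w, [/\ 0 <= v, 0 <= w, 0 < v + w,
    u * A 0 1 + v * B 0 1 + w * C 0 1 = 0 &
    u * A 0 2 + v * B 0 2 + w * C 0 2 = 0].
Proof.
rewrite /deSitter/= /lorentz => hA hnc.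
have a0 : 0 < A 0 1 ^+ 2 + A 0 2 ^+ 2.
  have -> : A 0 1 ^+ 2 + A 0 2 ^+ 2 = 1 + A 0 0 ^+ 2 by rewrite -hA; ring.
  by have := sqr_ge0 (A 0 0); lra.
have [[N [hB hC]]|[v [w [v0 w0 vw h2 h1]]]] := affine_pair_gt0
  (A 0 1 * B 0 1 + A 0 2 * B 0 2) (A 0 1 * B 0 2 - A 0 2 * B 0 1)
  (A 0 1 * C 0 1 + A 0 2 * C 0 2) (A 0 1 * C 0 2 - A 0 2 * C 0 1).
  case: hnc.
  pose n : 'rV[R]_2 :=
    \row_(j < 2) [:: A 0 1 - N * A 0 2; A 0 2 + N * A 0 1]`_j.
  have nA : half_plane n (proj23 A).
    by rewrite /half_plane /proj23 /n /= !mxE/=; move: a0; lra.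
  exists n.
    apply/eqP => n0; move: nA; rewrite n0 /half_plane/= !mxE.
    by rewrite !mul0r addr0 ltxx.
  split => //.
    by rewrite /half_plane /proj23 /n /= !mxE/=; move: hB; lra.
  by rewrite /half_plane /proj23 /n /= !mxE/=; move: hC; lra.
(* With [d = v b + w c] on projections, [|a|^2 d - (a.d) a = (a^perp.d) a^perp], and [a^perp.d = 0]
   by [h2]. *)
exists (- (v * (A 0 1 * B 0 1 + A 0 2 * B 0 2)
           + w * (A 0 1 * C 0 1 + A 0 2 * C 0 2))),
  ((A 0 1 ^+ 2 + A 0 2 ^+ 2) * v), ((A 0 1 ^+ 2 + A 0 2 ^+ 2) * w).
split.
- by rewrite mulr_ge0// ltW.
- by rewrite mulr_ge0// ltW.
- by rewrite -mulrDr mulr_gt0.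
- transitivity (- A 0 2 * (v * (A 0 1 * B 0 2 - A 0 2 * B 0 1)
                           + w * (A 0 1 * C 0 2 - A 0 2 * C 0 1))).
    by ring.
  by rewrite h2 mulr0.
- transitivity (A 0 1 * (v * (A 0 1 * B 0 2 - A 0 2 * B 0 1)
                         + w * (A 0 1 * C 0 2 - A 0 2 * C 0 1))).
    by ring.
  by rewrite h2 mulr0.
Qed.

Lemma noncontractible_lorentz_lt A B C :
  spatiolateral A B C -> ~ contractible_triangle A B C ->
  lorentz B C < lorentz A B * lorentz A C.
Proof.
move=> [[hA hB hC] _ [sAB sAC _]] hnc.
have r1 := spacelike_side_lt1 hA hB sAB.
have q1 := spacelike_side_lt1 hA hC sAC.
have [u [v [w [v0 w0 vw e1 e2]]]] := noncontractible_combination hA hnc.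
rewrite ltNge; apply/negP => pqr.
(* Only the first coordinate [t] of [T = u A + v B + w C] survives, so [<<T,T>> = - t^2]. *)
pose t := u * A 0 0 + v * B 0 0 + w * C 0 0.
have : - t ^+ 2 = u ^+ 2 * lorentz A A + v ^+ 2 * lorentz B B
    + w ^+ 2 * lorentz C C + 2 * u * v * lorentz A B
    + 2 * u * w * lorentz A C + 2 * v * w * lorentz B C.
  transitivity (- t ^+ 2 + (u * A 0 1 + v * B 0 1 + w * C 0 1) ^+ 2
                + (u * A 0 2 + v * B 0 2 + w * C 0 2) ^+ 2).
    by rewrite e1 e2; ring.
  by rewrite /t /lorentz; ring.
rewrite hA hB hC.
move: (lorentz A B) (lorentz A C) (lorentz B C) r1 q1 pqr => r q p r1 q1 pqr E.
have P1 := sqr_ge0 t; have P2 := sqr_ge0 (u + v * r + w * q).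
have P3 : 0 <= v * w * (p - r * q) by rewrite !mulr_ge0// subr_ge0.
have P4 : 0 < v ^+ 2 * (1 - r ^+ 2) + w ^+ 2 * (1 - q ^+ 2).
  have R1 : 0 < 1 - r ^+ 2 by rewrite subr_gt0.
  have Q1 : 0 < 1 - q ^+ 2 by rewrite subr_gt0.
  have [v_gt0|v_le0] := ltrP 0 v.
    apply: ltr_pwDl; first by rewrite mulr_gt0// exprn_gt0.
    by rewrite mulr_ge0 ?sqr_ge0// ltW.
  apply: ltr_wpDl; first by rewrite mulr_ge0 ?sqr_ge0// ltW.
  by rewrite mulr_gt0// exprn_gt0//; lra.
have : - t ^+ 2 = (u + v * r + w * q) ^+ 2
    + (v ^+ 2 * (1 - r ^+ 2) + w ^+ 2 * (1 - q ^+ 2))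
    + 2 * (v * w * (p - r * q)) by rewrite E; ring.
by move: P1 P2 P3 P4; lra.
Qed.

(** * Angles in terms of the Gram entries, and the law of cosines *)

Lemma vertex_angle_cosh_sinh A B C
    (p := lorentz B C) (q := lorentz A C) (r := lorentz A B) :
  spatiolateral A B C -> ~ contractible_triangle A B C ->
  cosh (vertex_angle A B C)
    = (r * q - p) / (Num.sqrt (1 - r ^+ 2) * Num.sqrt (1 - q ^+ 2)) /\
  sinh (vertex_angle A B C)
    = Num.sqrt (p ^+ 2 + q ^+ 2 + r ^+ 2 - 2 * r * q * p - 1)
      / (Num.sqrt (1 - r ^+ 2) * Num.sqrt (1 - q ^+ 2)).
Proof.
move=> hABC hnc; have := noncontractible_lorentz_lt hABC hnc.
move: hABC => [[hA hB hC] _ [sAB sAC _]].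
have := spacelike_side_lt1 hA hB sAB.
have := spacelike_side_lt1 hA hC sAC.
have := deSitter_gram_ge0 hA hB hC.
rewrite /vertex_angle lorentz_unit_tangent// !lnorm_cross// -/p -/q -/r.
move: p q r => p q r K0 q1 r1 pqr.
have R0 : 0 < Num.sqrt (1 - r ^+ 2) by rewrite sqrtr_gt0 subr_gt0.
have Q0 : 0 < Num.sqrt (1 - q ^+ 2) by rewrite sqrtr_gt0 subr_gt0.
have R2 : Num.sqrt (1 - r ^+ 2) ^+ 2 = 1 - r ^+ 2.
  by rewrite sqr_sqrtr// subr_ge0 ltW.
have Q2 : Num.sqrt (1 - q ^+ 2) ^+ 2 = 1 - q ^+ 2.
  by rewrite sqr_sqrtr// subr_ge0 ltW.
have K2 := sqr_sqrtr K0.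
have D0 := mulr_gt0 R0 Q0.
have D2 : (Num.sqrt (1 - r ^+ 2) * Num.sqrt (1 - q ^+ 2)) ^+ 2
  = (1 - r ^+ 2) * (1 - q ^+ 2) by rewrite exprMn R2 Q2.
set D := Num.sqrt _ * Num.sqrt _ in D0 D2 *.
set K := _ - 1 in K0 K2 *.
have y0 : 0 <= Num.sqrt K / D by rewrite divr_ge0 ?sqrtr_ge0// ltW.
(* This rests on [(r q - p)^2 - (1 - r^2)(1 - q^2) = K]. It yields both [1 <= cosh] and the value of
   [sinh]. *)
have xy : ((r * q - p) / D) ^+ 2 - 1 = (Num.sqrt K / D) ^+ 2.
  rewrite !expr_div_n K2 -[1](divff (lt0r_neq0 (exprn_gt0 2 D0))) -mulrBl.
  by congr (_ / _); rewrite D2 /K; ring.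
have x1 : 1 <= (r * q - p) / D.
  have x0 : 0 <= (r * q - p) / D by rewrite divr_ge0 ?subr_ge0 ?ltW.
  by rewrite -(@expr_ge1 _ 2)// -subr_ge0 xy sqr_ge0.
have -> : `|(p - r * q) / D| = (r * q - p) / D.
  by rewrite normrM normfV (gtr0_norm D0) ltr0_norm ?subr_lt0// opprB.
by split; [case: (arcoshP x1) | exact: sinh_arcosh].
Qed.

Lemma noncontractible_cosine_law A B C :
  spatiolateral A B C -> ~ contractible_triangle A B C ->
  cosh (vertex_angle A B C) =
    cosh (vertex_angle B A C) * cosh (vertex_angle C A B)
    + cos (side_length B C) * sinh (vertex_angle B A C)
      * sinh (vertex_angle C A B).
Proof.
move=> hABC hnc.
have [chA _] := vertex_angle_cosh_sinh hABC hnc.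
have [chB shB] := vertex_angle_cosh_sinh (spatiolateral_swap12 hABC)
  (fun h => hnc (contractible_triangle_swap12 h)).
have [chC shC] := vertex_angle_cosh_sinh
  (spatiolateral_swap12 (spatiolateral_swap23 hABC))
  (fun h => hnc (contractible_triangle_swap23 (contractible_triangle_swap12 h))).
have [[hA hB hC] _ [sAB sAC sBC]] := hABC.
have := deSitter_gram_ge0 hA hB hC.
have := spacelike_side_lt1 hA hB sAB.
have := spacelike_side_lt1 hA hC sAC.
have := spacelike_side_lt1 hB hC sBC.
rewrite chA chB shB chC shC cos_side_length//.
rewrite (lorentzC B A) (lorentzC C A) (lorentzC C B).
move: (lorentz A B) (lorentz A C) (lorentz B C) => r q p p1 q1 r1 K0.
(* The Gram expression is symmetric in the vertices, so all three angles share one square root. *)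
have eB : q ^+ 2 + p ^+ 2 + r ^+ 2 - 2 * r * p * q - 1
  = p ^+ 2 + q ^+ 2 + r ^+ 2 - 2 * r * q * p - 1 by ring.
have eC : r ^+ 2 + p ^+ 2 + q ^+ 2 - 2 * q * p * r - 1
  = p ^+ 2 + q ^+ 2 + r ^+ 2 - 2 * r * q * p - 1 by ring.
rewrite eB eC.
have K2 := sqr_sqrtr K0.
have P0 : Num.sqrt (1 - p ^+ 2) != 0 by rewrite gt_eqF// sqrtr_gt0 subr_gt0.
have Q0 : Num.sqrt (1 - q ^+ 2) != 0 by rewrite gt_eqF// sqrtr_gt0 subr_gt0.
have R0 : Num.sqrt (1 - r ^+ 2) != 0 by rewrite gt_eqF// sqrtr_gt0 subr_gt0.
have P2 : Num.sqrt (1 - p ^+ 2) ^+ 2 = 1 - p ^+ 2.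
  by rewrite sqr_sqrtr// subr_ge0 ltW.
set P := Num.sqrt (1 - p ^+ 2) in P0 P2 *.
set Q := Num.sqrt (1 - q ^+ 2) in Q0 *.
set S := Num.sqrt (1 - r ^+ 2) in R0 *.
set K := Num.sqrt _ in K2 *.
(* Both sides are brought over [P^2 Q S]; the numerators then agree by the identity for [K], where
   [K] now names the square root. *)
transitivity (((r * q - p) * P ^+ 2) / (P ^+ 2 * Q * S)).
  by field; rewrite P0 Q0 R0.
transitivity (((r * p - q) * (q * p - r) + p * K ^+ 2) / (P ^+ 2 * Q * S)).
  by congr (_ / _); rewrite P2 K2; ring.
by field; rewrite P0 Q0 R0.
Qed.

End Lorentz.

Unset Implicit Arguments.

Theorem theorem5p7 (R : realType) (A B C : 'rV[R]_3)
    (hABC : spatiolateral A B C) (hnc : ~ contractible_triangle A B C) :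
  let a := side_length B C in
  let b := side_length A C in
  let c := side_length A B in
  let alpha := vertex_angle A B C in
  let beta := vertex_angle B A C in
  let gamma := vertex_angle C A B in
  [/\ cosh alpha = cosh beta * cosh gamma + cos a * sinh beta * sinh gamma,
      cosh beta = cosh alpha * cosh gamma + cos b * sinh alpha * sinh gamma &
      cosh gamma = cosh alpha * cosh beta + cos c * sinh alpha * sinh beta].
Proof.
move=> a b c alpha beta gamma; rewrite /a /b /c /alpha /beta /gamma; split.
- exact: noncontractible_cosine_law.
(* The other two formulas are the first one for the triples [B, A, C] and [C, A, B], after swapping
   the arms of some angles. *)
- rewrite (vertex_angleC C A B).
  apply: noncontractible_cosine_law; first exact: spatiolateral_swap12.
  by move=> /contractible_triangle_swap12.
- rewrite (vertex_angleC A B C) (vertex_angleC B A C).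
  apply: noncontractible_cosine_law.
    exact: spatiolateral_swap12 (spatiolateral_swap23 hABC).
  by move=> /contractible_triangle_swap12 /contractible_triangle_swap23.
Qed.
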